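(* There exist absolute constants $C,c>0$ such that for every prime power $q$, with $G=\mathrm{SL}(2,q)$, and every $a\in G$, \[\mathbb E_{b,b'\in G}\ \Pr\big[\mathbf C(ab^{-1})\mathbf C(b)=\mathbf C(ab'^{-1})\mathbf C(b')\big]\le\frac{1+\gamma}{|G|},\qquad \gamma=C|G|^{-c},\] where $b,b'$ are uniform and independent in $G$, and the probability is over the four independent random conjugations.
   Context: For $x\in G$, $\mathbf C(x)$ denotes the random element $u^{-1}xu$ with $u$ uniform in $G$ (i.e. a uniform element of the conjugacy class of $x$); distinct occurrences of $\mathbf C$ use independent choices of $u$. $\mathrm{SL}(2,q)$ is the group of $2\times2$ determinant-one matrices over $\mathbb F_q$. *)

(* Defs.v *)
From Stdlib Require Import Reals.
From HB Require Import structures.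
From mathcomp Require Import all_boot all_order all_algebra all_fingroup all_field.
Set Implicit Arguments. Unset Strict Implicit. Unset Printing Implicit Defensive.

Definition SL2 (F : finFieldType) : {set 'M[F]_2} :=
  [set M : 'M[F]_2 | (\det M == 1)%R].

(* Conjugation u^{-1} x u (the random C(x) is mxconj u x with u uniform in G). *)
Definition mxconj (F : finFieldType) (u x : 'M[F]_2) : 'M[F]_2 :=
  (invmx u *m x *m u)%R.

(* Number of tuples (b, b', u1, u2, u3, u4) in G^6 with
   (a b^{-1})^{u1} b^{u2} = (a b'^{-1})^{u3} b'^{u4}.  Dividing by |G|^6 gives
   E_{b,b'} Pr[C(ab^{-1})C(b) = C(ab'^{-1})C(b')]. *)
Definition collision_count (F : finFieldType) (a : 'M[F]_2) : nat :=
  \sum_(b in SL2 F) \sum_(b' in SL2 F)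
   \sum_(u1 in SL2 F) \sum_(u2 in SL2 F) \sum_(u3 in SL2 F) \sum_(u4 in SL2 F)
     ((mxconj u1 (a *m invmx b) *m mxconj u2 b)%R ==
      (mxconj u3 (a *m invmx b') *m mxconj u4 b')%R : nat).

Definition collision_prob (F : finFieldType) (a : 'M[F]_2) : R :=
  Rdiv (INR (collision_count a)) (INR (#|SL2 F| ^ 6)).

(* Main.v *)
Require Import Defs.
From Stdlib Require Import Reals Lra.
From HB Require Import structures.
From mathcomp Require Import all_boot all_order all_algebra all_fingroup all_field all_character.
Set Implicit Arguments. Unset Strict Implicit. Unset Printing Implicit Defensive.
Import Order.TTheory GroupScope GRing.Theory Num.Theory.
Local Open Scope ring_scope.

(** Let $G=SL(2,q)$. For random $b$ the law of $C(ab^{-1})C(b)$ is a class function, so Parseval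
    expresses the collision probability through irreducible characters. Averaging over conjugations
    gives $E\chi(C(x)y)=\chi(x)\chi(y)/\chi(1)$, and averaging $\chi(ab^{-1})\chi(b)$ over $b$ gives
    $\chi(a)/\chi(1)$. Hence $\chi$ has mean $\chi(a)/\chi(1)^2$, and the probability equals
    $|G|^{-1}\sum_\chi|\chi(a)|^2/\chi(1)^4$ ([interleaved_collision_irr]).

    The trivial character gives the main term $1/|G|$. Since $|\chi(a)|\le\chi(1)$, the others add
    at most $|G|^{-1}\sum\chi(1)^{-2}$, which is small because every nontrivial degree is at least
    $(q-1)/2$ ([SL2_degree_lower_bound]): a nontrivial character of the unipotent subgroup has at
    least $(q-1)/2$ conjugates under the diagonal torus. With $\sum\chi(1)^2=|G|$ the relative error
    is at most $16|G|/(q-1)^4$, and $|G|\le q^3$ makes this $O(|G|^{-1/3})$. *)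

Section RealBound.

(** * Real arithmetic: from the count to the rate *)

Local Open Scope R_scope.

                                                                                     
(** To be used with $x=|G|$, $D=q-1$ and $X$ the collision count. With $y=x^{1/3}\le 2D$, the
    relative error is $16x/D^4=16y^3/D^4\le 256/y$. *)
Lemma collision_rate_le (X x D : R) : 0 < x -> 0 < D -> x <= (2 * D) ^ 3 ->
  X * D ^ 4 <= x ^ 5 * (D ^ 4 + 16 * x) ->
  X / x ^ 6 <= (1 + 256 * Rpower x (- (1 / 3))) / x.
Proof.
move=> x0 D0 x_le X_le.
pose y := Rpower x (1 / 3).
have y0 : 0 < y by apply: exp_pos.
have third : 1 / 3 * INR 3 = 1 by rewrite /=; field.
have y3 : y ^ 3 = x by rewrite -Rpower_pow // /y Rpower_mult third Rpower_1.
have y_le : y <= 2 * D.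
  have D2 : 0 < 2 * D by lra.
  rewrite -[X in _ <= X](Rpower_1 _ D2) -third (Rmult_comm (1 / 3)) -Rpower_mult Rpower_pow //.
  by apply: Rle_Rpower_l; lra.
have y4_le : y ^ 4 <= (2 * D) ^ 4 by apply: pow_incr; lra.
rewrite Rpower_Ropp -/y.
have D4 : 0 < D ^ 4 by apply: pow_lt.
have x6 : 0 < x ^ 6 by apply: pow_lt.
have x5 : 0 < x ^ 5 by apply: pow_lt.
apply: (Rle_trans _ ((1 + 16 * x / D ^ 4) / x)).
  apply: (Rmult_le_reg_r (x ^ 6 * D ^ 4)); first exact: Rmult_lt_0_compat.
  have -> : X / x ^ 6 * (x ^ 6 * D ^ 4) = X * D ^ 4 by field; lra.
  have -> : (1 + 16 * x / D ^ 4) / x * (x ^ 6 * D ^ 4) = x ^ 5 * (D ^ 4 + 16 * x).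
    by field; lra.
  exact: X_le.
apply: Rmult_le_compat_r; first by apply/Rlt_le/Rinv_0_lt_compat.
apply: Rplus_le_compat_l; apply: (Rmult_le_reg_r (D ^ 4 * y)).
  exact: Rmult_lt_0_compat.
have -> : 16 * x / D ^ 4 * (D ^ 4 * y) = 16 * y ^ 4 by rewrite -y3; field; lra.
have -> : 256 * / y * (D ^ 4 * y) = 16 * (2 * D) ^ 4 by field; lra.
by apply: Rmult_le_compat_l => //; lra.
Qed.
End RealBound.

                                                                                             
From mathcomp Require Import ring.

(** * Character sums and collisions in a finite group *)

Section Fourier.
Variables (gT : finGroupType) (G : {group gT}).
Implicit Types (x y g : gT) (i : Iirr G).

(** The convolution identity $\chi*\chi=(|G|/\chi(1))\,\chi$: generalized orthogonality with both
    indices equal, after replacing $x$ by its inverse. *)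
Lemma sum_irr_mulVg i y :
  \sum_(x in G) 'chi_i (y * x^-1)%g * 'chi_i x = #|G|%:R * ('chi_i y / 'chi_i 1%g).
Proof.
have := generalized_orthogonality_relation y i i.
rewrite eqxx mul1r => <-; rewrite mulVKf ?neq0CG //.
rewrite [RHS](reindex_inj invg_inj) /=; apply: eq_big => [x|x Gx]; first by rewrite groupV.
by rewrite invgK -['chi_i (x^-1 * y)%g](cfunJ _ _ (groupVr Gx)) conjgE invgK mulgA mulVKg.
Qed.

(** As a function of $x$ the left side is a class function. By generalized orthogonality it is
    orthogonal to every $\chi_j$ with $j\ne i$, so it is a multiple of $\chi_i$. *)
Lemma sum_irr_conjg i x y : x \in G -> y \in G ->
  \sum_(u in G) 'chi_i (x ^ u * y)%g = #|G|%:R * ('chi_i x * 'chi_i y / 'chi_i 1%g).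
Proof.
move=> Gx Gy.
(* Class functions on [G] must vanish outside [G], hence the cut-off. *)
pose f x : algC := if x \in G then \sum_(u in G) 'chi_i (x ^ u * y)%g else 0.
have fP : is_class_fun <<G>> (finfun f).
  rewrite genGid; apply: intro_class_fun => [z v Gz Gv | z /negPf]; rewrite /f; last by move->.
  rewrite groupJ // Gz [RHS](reindex_inj (mulgI v)) /=.
  by apply: eq_big => [u|u _]; rewrite ?groupMl // conjgM.
pose phi : 'CF(G) := Cfun 0 fP.
have phiE z : z \in G -> phi z = \sum_(u in G) 'chi_i (z ^ u * y)%g.
  by move=> Gz; rewrite cfunE /f Gz.
have cfdot_phi j : '[phi, 'chi_j] = #|G|%:R * ((i == j)%:R * ('chi_i y / 'chi_i 1%g)).
  rewrite cfdotE (eq_bigr (fun z => \sum_(u in G) 'chi_i (z ^ u * y)%g * ('chi_j z)^*)).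
    rewrite exchange_big mulr_sumr [RHS]mulr_natl -[RHS]sumr_const; apply: eq_bigr => u Gu /=.
    rewrite -generalized_orthogonality_relation; congr (_ * _).
    (* The substitution $z\mapsto z^u$ leaves $\chi_j$ unchanged, so every $u$ contributes the same
       amount. *)
    rewrite [RHS](reindex_inj (conjg_inj u)).
    apply: eq_big => [z|z Gz] /=; first by rewrite groupJr.
    by rewrite irr_inv cfunJ.
  by move=> z Gz; rewrite phiE // mulr_suml.
rewrite -phiE // [phi]cfun_sum_cfdot sum_cfunE (bigD1 i) //= big1 => [|j ji].
  by rewrite addr0 cfunE cfdot_phi eqxx mul1r -[LHS]mulrA
    [X in _ * X = _]mulrC ['chi_i x * (_ / _)]mulrA.
by rewrite cfunE cfdot_phi eq_sym (negPf ji) mul0r mulr0 mul0r.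
Qed.

(** Parseval: the collisions number $\sum_g p(g)^2=|G|\,\langle p,p\rangle$, where $p(g)$ is the
    size of the fibre of [f] over $g$. The second hypothesis makes $p$ a class function, so its norm
    expands over irreducible characters. *)
Lemma collision_irr (T : finType) (W : {set T}) (f : T -> gT) :
    {in W, forall w, f w \in G} ->
    {in G &, forall g u, #|[set w in W | f w == (g ^ u)%g]| = #|[set w in W | f w == g]|} ->
  (\sum_(s in W) \sum_(t in W) (f s == f t))%N%:R
    = #|G|%:R^-1 * \sum_i `|\sum_(w in W) 'chi[G]_i (f w)| ^+ 2.
Proof.
move=> Gf fJ.
pose p g : algC := #|[set w in W | f w == g]|%:R.
have pE g : p g = \sum_(w in W) (f w == g)%:R.
  rewrite /p -sum1dep_card natr_sum big_mkcondr /=.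
  by apply: eq_bigr => w _; case: (f w == g).
have fP : is_class_fun <<G>> (finfun p).
  rewrite genGid; apply: intro_class_fun => [z v Gz Gv | z nGz]; first by rewrite /p fJ.
  rewrite pE big1 // => w Ww; case: eqP => // fz.
  by rewrite -fz Gf in nGz.
pose phi : 'CF(G) := Cfun 0 fP.
have phiE z : phi z = p z by rewrite cfunE.
have sum_p (F : gT -> algC) : \sum_(g in G) p g * F g = \sum_(w in W) F (f w).
  under eq_bigr do rewrite pE mulr_suml.
  rewrite exchange_big /=; apply: eq_bigr => w Ww.
  rewrite (bigD1 (f w)) ?Gf //= eqxx mul1r big1 ?addr0 // => g /andP[_ nfg].
  by rewrite eq_sym (negPf nfg) mul0r.
have -> : (\sum_(s in W) \sum_(t in W) (f s == f t))%N%:R = #|G|%:R * '[phi].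
  rewrite cfdotE mulVKf ?neq0CG //.
  rewrite [RHS](eq_bigr (fun g => p g * p g)) => [|g _];
    last by rewrite !phiE [X in X^*]/p conj_natr.
  rewrite sum_p natr_sum; apply: eq_bigr => s _; rewrite pE natr_sum.
  by apply: eq_bigr => t _; rewrite eq_sym.
rewrite cfdot_sum_irr !mulr_sumr; apply: eq_bigr => i _.
have -> : '[phi, 'chi_i] = #|G|%:R^-1 * (\sum_(w in W) 'chi_i (f w))^*.
  rewrite cfdotE; under eq_bigr do rewrite phiE.
  by rewrite (sum_p (fun g => ('chi_i g)^*)) rmorph_sum.
rewrite -normCK normrM norm_conjC normfV normr_nat exprMn mulrA; congr (_ * _).
by rewrite expr2 mulrA mulfV ?mul1r ?neq0CG.
Qed.

Lemma interleaved_collision_irr a : a \in G ->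
  (\sum_(b in G) \sum_(b' in G) \sum_(u1 in G) \sum_(u2 in G) \sum_(u3 in G)
     \sum_(u4 in G) ((a * b^-1) ^ u1 * b ^ u2 == (a * b'^-1) ^ u3 * b' ^ u4)%g)%N%:R
  = #|G|%:R ^+ 5 * \sum_i (`|'chi[G]_i a| / 'chi_i 1%g ^+ 2) ^+ 2 :> algC.
Proof.
move=> Ga.
pose W := setX G (setX G G).
pose f (w : gT * (gT * gT)) := ((a * w.1^-1) ^ w.2.1 * w.1 ^ w.2.2)%g.
have bigW (V : nmodType) (F : gT * (gT * gT) -> V) :
    \sum_(w in W) F w = \sum_(b in G) \sum_(u in G) \sum_(v in G) F (b, (u, v)).
  under [RHS]eq_bigr do rewrite pair_big /=.
  rewrite pair_big /=; apply: eq_big => [[b [u v]]|[b [u v]] _] //=.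
  by rewrite !inE.
transitivity ((\sum_(s in W) \sum_(t in W) (f s == f t))%N%:R : algC).
  congr (_%:R); rewrite bigW; apply: eq_bigr => b _; rewrite exchange_big /=.
  apply: eq_bigr => u _; rewrite exchange_big; apply: eq_bigr => v _.
  by rewrite bigW.
rewrite collision_irr; first last.
- move=> g u Gg Gu /=.
  (* Multiplying both conjugators on the right by $v$ permutes [W] and conjugates the value of [f]
     by $v$; fibres over conjugate elements are thus equinumerous. *)
  pose h v (w : gT * (gT * gT)) := (w.1, (w.2.1 * v, w.2.2 * v)%g).
  have hK v : cancel (h v) (h v^-1%g) by case=> b [x y]; rewrite /h /= !mulgK.
  rewrite -(card_imset [pred w | w \in [set w in W | f w == g]] (can_inj (hK u))).
  apply: eq_card => /= w; apply/idP/imsetP=> [|[w' + ->]].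
    rewrite !inE => /andP[/and3P[Gb Gx Gy] /eqP fw]; exists (h u^-1%g w); last first.
      by rewrite -{1}(invgK u) hK.
    rewrite !inE /= !groupM ?groupV // Gb /=.
    by rewrite /f /= !conjgM -conjMg -/(f w) fw conjgK.
  rewrite !inE /= => /andP[/and3P[Gb Gx Gy] /eqP fw].
  by rewrite !groupM // Gb /= /f /= !conjgM -conjMg -/(f w') fw.
- by case=> b [u v]; rewrite !inE /f /= => /and3P[Gb Gu Gv]; rewrite groupM ?groupJ ?groupM ?groupV.
have nzG := neq0CG G.
have E i : \sum_(w in W) 'chi_i (f w) = #|G|%:R ^+ 3 * ('chi[G]_i a / 'chi_i 1%g ^+ 2).
  rewrite bigW /f /=.
  transitivity (\sum_(b in G) #|G|%:R ^+ 2 / 'chi[G]_i 1%g * ('chi_i (a * b^-1)%g * 'chi_i b)).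
    (* The first conjugator is averaged by the product formula; the second then disappears, as
       $\chi(b^v)=\chi(b)$, and only contributes a factor $|G|$. *)
    apply: eq_bigr => b Gb; rewrite exchange_big /=.
    under eq_bigr => u Gu do rewrite sum_irr_conjg ?groupM ?groupV ?groupJ // cfunJ //.
    by rewrite sumr_const -[LHS]mulr_natl mulrA -expr2 [RHS]mulrAC [LHS]mulrA.
  rewrite -mulr_sumr sum_irr_mulVg.
  by rewrite mulrACA -exprSr [_^-1 * _]mulrCA -invfM -expr2.
rewrite (eq_bigr (fun i => #|G|%:R ^+ 6 * (`|'chi[G]_i a| / 'chi_i 1%g ^+ 2) ^+ 2)).
  by rewrite -mulr_sumr mulrA exprS mulKf.
move=> i _; rewrite E normrM normrX normr_nat exprMn -exprM.
by rewrite normrM normfV normrX [`|'chi_i 1%g|]ger0_norm ?ltW ?irr1_gt0.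
Qed.

(** Each constituent adds multiplicity times degree, a positive integer, to the degree of [chi]. *)
Lemma card_irr_constt_le_char1 (chi : 'CF(G)) : chi \is a character ->
  #|irr_constt chi|%:R <= chi 1%g.
Proof.
move=> Nchi; rewrite {2}[chi]cfun_sum_constt sum_cfunE -sum1_card natr_sum.
apply: ler_sum => i; rewrite cfunE inE /= => nz.
have := Cnat_cfdot_char_irr i Nchi; have := Cnat_irr1 i.
move: nz (irr1_neq0 i) => /[swap] + + /natrP[m em] /natrP[n en].
rewrite em en -natrM !pnatr_eq0 ler_nat => m0 n0.
by rewrite muln_gt0 !lt0n n0 m0.
Qed.

                                                                                                                       
Lemma interleaved_collision_le (d : nat) a : a \in G ->
  (forall i, i != 0 -> d%:R <= 2 * 'chi[G]_i 1%g) ->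
  ((\sum_(b in G) \sum_(b' in G) \sum_(u1 in G) \sum_(u2 in G) \sum_(u3 in G)
     \sum_(u4 in G) ((a * b^-1) ^ u1 * b ^ u2 == (a * b'^-1) ^ u3 * b' ^ u4)%g)
   * d ^ 4 <= #|G| ^ 5 * (d ^ 4 + 16 * #|G|))%N.
Proof.
move=> Ga dP; rewrite -(ler_nat algC) natrM interleaved_collision_irr //.
rewrite [in leRHS]natrM natrD !natrX natrM.
rewrite -mulrA ler_wpM2l ?exprn_ge0 ?ler0n // mulr_suml -irr_sum_square.
rewrite (bigD1 0) //= lerD //.
  by rewrite irr0 !cfun1E Ga group1 normr1 expr1n divr1 expr1n mul1r.
rewrite mulr_sumr [leRHS](bigD1 0) //= -[leLHS]add0r.
apply: lerD; first by rewrite mulr_ge0 ?ler0n // exprn_ge0 // ltW ?irr1_gt0.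
apply: ler_sum => i /dP le_d; have c_gt0 := irr1_gt0 i; have c_ge0 := ltW c_gt0.
(* Both sides are squares, so it suffices that $(|\chi(a)|/\chi(1)^2)\,d^2\le 4\chi(1)$, which
   follows from $|\chi(a)|\le\chi(1)$ and $d\le 2\chi(1)$. *)
have -> : 16 * 'chi_i 1%g ^+ 2 = (2 ^+ 2 * 'chi_i 1%g) ^+ 2 by rewrite exprMn -!natrX.
rewrite (exprM _ 2 2) -exprMn.
have le_chi : `|'chi_i a| / 'chi_i 1%g ^+ 2 <= ('chi_i 1%g)^-1.
  rewrite expr2 invfM mulrA ler_piMl ?invr_ge0 // ler_pdivrMr // mul1r.
  by rewrite char1_ge_norm ?irr_char.
have le_d2 : d%:R ^+ 2 <= (2 * 'chi_i 1%g) ^+ 2.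
  by apply: lerXn2r => //; rewrite nnegrE ?ler0n // mulr_ge0 // ler0n.
have chi_ge0 : 0 <= `|'chi_i a| / 'chi_i 1%g ^+ 2.
  by rewrite mulr_ge0 ?normr_ge0 // invr_ge0 exprn_ge0.
have d2_ge0 : 0 <= d%:R ^+ 2 :> algC by rewrite exprn_ge0 ?ler0n.
have {le_chi le_d2} := ler_pM chi_ge0 d2_ge0 le_chi le_d2.
have -> : ('chi_i 1%g)^-1 * (2 * 'chi_i 1%g) ^+ 2 = 2 ^+ 2 * 'chi_i 1%g.
  by rewrite exprMn mulrCA ['chi_i 1%g ^+ 2]expr2 mulKf ?irr1_neq0.
move=> le_mul.
by apply: lerXn2r => //; rewrite nnegrE mulr_ge0 // exprn_ge0 // ler0n.
Qed.
End Fourier.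

(** The normalizer of [U] in [G] fixes the restriction of ['chi_i], hence permutes its constituents:
    all the conjugates counted are constituents. *)
Lemma card_conjg_Iirr_le_char1 (gT : finGroupType) (G U : {group gT}) (T : {set gT})
    (i : Iirr G) (j : Iirr U) :
    U \subset G -> T \subset 'N_G(U) -> j \in irr_constt ('Res[U] 'chi_i) ->
  #|[set conjg_Iirr j t | t in T]|%:R <= 'chi_i 1%g.
Proof.
move=> sUG sTN Cj; rewrite -(cfRes1 U).
apply: le_trans (card_irr_constt_le_char1 (cfRes_char _ (irr_char i))).
rewrite ler_nat; apply/subset_leq_card/subsetP=> _ /imsetP[t Tt ->].
have /setIP[Gt Nt] := subsetP sTN t Tt.
have Res_t : ('Res[U] 'chi_i ^ t)%CF = 'Res[U] 'chi_i.
  by rewrite (cfConjgRes_norm _ Nt (subsetP (normG G) t Gt)) cfConjg_id.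
by move: Cj; rewrite !irr_consttE conjg_IirrE -{2}Res_t cfConjg_iso.
Qed.

(** * The group SL(2,q) and its elementary subgroups *)

Section SL2.
Variable F : finFieldType.
Implicit Types (x y t : F) (M N : 'M[F]_2).

Definition mx2 (a b c d : F) : 'M[F]_2 :=
  \matrix_(i, j) if i == 0 then (if j == 0 then a else b) else (if j == 0 then c else d).

Lemma mx2E M : M = mx2 (M 0 0) (M 0 1) (M 1 0) (M 1 1).
Proof.
by apply/matrixP=> -[[|[|//]] ?] [[|[|//]] ?]; rewrite mxE /=; congr (M _ _); apply: val_inj.
Qed.

Lemma mul_mx2 a b c d a' b' c' d' :
  mx2 a b c d *m mx2 a' b' c' d'
    = mx2 (a * a' + b * c') (a * b' + b * d') (c * a' + d * c') (c * b' + d * d').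
Proof.
by apply/matrixP=> i j; rewrite !mxE !big_ord_recl big_ord0 !mxE addr0 /=; do 2![case: (_ == 0)].
Qed.

Lemma mx2_SL2 a b c d : (mx2 a b c d \in SL2 F) = (a * d - b * c == 1).
Proof.
rewrite inE (expand_det_row _ 0) !big_ord_recl big_ord0 /cofactor !det_mx11 !mxE /=.
by rewrite expr0 expr1 addr0 mul1r mulN1r mulrN.
Qed.

Lemma SL2_unitmx M : M \in SL2 F -> M \in unitmx.
Proof. by rewrite inE unitmxE => /eqP->; rewrite unitr1. Qed.

(** [SL2 F] is only a set of matrices; this copy lives in a finite group type, where character
    theory is available. *)
Definition SL2gl : {set {'GL_2[F]}} := [set u : {'GL_2[F]} | (GLval u : 'M[F]_2) \in SL2 F].

Lemma SL2gl_group_set : group_set SL2gl.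
Proof.
apply/group_setP; split=> [|u v]; rewrite !inE ?det1 //.
by rewrite GL_MxE det_mulmx => /eqP-> /eqP->; rewrite mulr1.
Qed.
Canonical SL2gl_group := Group SL2gl_group_set.

Definition toGL M : {'GL_2[F]} := insubd (1%g : {'GL_2[F]}) M.

Lemma toGLK M : M \in SL2 F -> toGL M = M :> 'M[F]_2.
Proof. by move=> /SL2_unitmx uM; exact: (@insubdK _ _ {'GL_2[F]} 1%g M uM). Qed.

Lemma mem_toGL M : M \in SL2 F -> toGL M \in SL2gl.
Proof. by move=> SM; rewrite inE toGLK. Qed.

Lemma toGLM M N : M \in SL2 F -> N \in SL2 F -> toGL (M *m N) = (toGL M * toGL N)%g.
Proof.
move=> SM SN; apply: val_inj; change (GLval (toGL (M *m N)) = GLval (toGL M * toGL N)).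
rewrite GL_MxE !toGLK //.
by move: SM SN; rewrite !inE det_mulmx => /eqP-> /eqP->; rewrite mulr1.
Qed.

Definition upper x := toGL (mx2 1 x 0 1).
Definition lower x := toGL (mx2 1 0 x 1).
Definition torus t := toGL (mx2 t 0 0 t^-1).

Lemma upper_SL2 x : mx2 1 x 0 1 \in SL2 F.
Proof. by rewrite mx2_SL2 mulr1 mulr0 subr0. Qed.

Lemma lower_SL2 x : mx2 1 0 x 1 \in SL2 F.
Proof. by rewrite mx2_SL2 mulr1 mul0r subr0. Qed.

Lemma torus_SL2 t : t != 0 -> mx2 t 0 0 t^-1 \in SL2 F.
Proof. by move=> nzt; rewrite mx2_SL2 mul0r subr0 mulfV. Qed.

Lemma upperD x y : upper (x + y) = (upper x * upper y)%g.
Proof.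
rewrite /upper -toGLM ?upper_SL2 // mul_mx2; congr (toGL (mx2 _ _ _ _)); ring.
Qed.

Definition uppers : {set {'GL_2[F]}} := [set upper x | x in [set: F]].

Lemma uppers_group_set : group_set uppers.
Proof.
have upper0 : upper 0 = 1%g by apply: (mulgI (upper 0)); rewrite -upperD addr0 mulg1.
apply/group_setP; split=> [|_ _ /imsetP[x _ ->] /imsetP[y _ ->]].
  by rewrite -upper0 imset_f ?inE.
by rewrite -upperD imset_f ?inE.
Qed.
Canonical uppers_group := Group uppers_group_set.

Lemma mem_uppers x : upper x \in uppers. Proof. by rewrite imset_f ?inE. Qed.

Lemma uppers_sub : uppers \subset SL2gl.
Proof. by apply/subsetP=> _ /imsetP[x _ ->]; rewrite mem_toGL ?upper_SL2. Qed.

Lemma uppers_abelian : abelian uppers.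
Proof.
apply/centsP=> _ /imsetP[x _ ->] _ /imsetP[y _ ->].
by rewrite /commute -!upperD addrC.
Qed.

(** The torus acts on the unipotent coordinate through squares; this is the source of the factor 2
    in the degree bound. *)
Lemma upperJ_torus x t : t != 0 -> (upper (t ^+ 2 * x)%R ^ torus t)%g = upper x.
Proof.
move=> nzt; apply: (mulgI (torus t)); rewrite -conjgC.
rewrite /upper /torus -!toGLM ?upper_SL2 ?torus_SL2 // !mul_mx2.
by congr (toGL (mx2 _ _ _ _)); field.
Qed.

Definition weyl := toGL (mx2 0 1 (- 1) 0).

Lemma weyl_SL2 : mx2 0 1 (- 1) 0 \in SL2 F.
Proof. by rewrite mx2_SL2 mul0r mul1r sub0r opprK. Qed.

Lemma upperJ_weyl x : (upper (- x)%R ^ weyl)%g = lower x.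
Proof.
apply: (mulgI weyl); rewrite -conjgC.
rewrite /upper /lower /weyl -!toGLM ?upper_SL2 ?lower_SL2 ?weyl_SL2 // !mul_mx2.
by congr (toGL (mx2 _ _ _ _)); ring.
Qed.

Lemma torus_norm t : t != 0 -> torus t \in 'N_SL2gl(uppers).
Proof.
move=> nzt; rewrite inE mem_toGL ?torus_SL2 //= -groupV inE.
apply/subsetP=> _ /imsetP[_ /imsetP[x _ ->] ->].
by rewrite -(upperJ_torus _ nzt) conjgK mem_uppers.
Qed.

(** Gaussian elimination: a matrix with nonzero lower-left entry is a product upper, lower, upper.
    If that entry is 0, right multiplication by [lower 1] replaces it by the lower-right entry,
    nonzero since the determinant is 1. *)
Lemma SL2gl_sub_transvections (K : {group {'GL_2[F]}}) :
  (forall x, upper x \in K) -> (forall x, lower x \in K) -> SL2gl \subset K.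
Proof.
move=> Ku Kl.
have Kc M : M \in SL2 F -> M 1 0 != 0 -> toGL M \in K.
  rewrite (mx2E M); move: (M 0 0) (M 0 1) (M 1 0) (M 1 1) => a b c d.
  rewrite mxE /= => SM nzc.
  have detM : a * d - b * c = 1 by apply/eqP; rewrite -mx2_SL2.
  have -> : mx2 a b c d
      = mx2 1 ((a - 1) / c) 0 1 *m mx2 1 0 c 1 *m mx2 1 ((d - 1) / c) 0 1.
    rewrite !mul_mx2; have -> : b = (a * d - 1) / c by rewrite -detM; field.
    by congr mx2; field.
  have S1 x : mx2 1 x 0 1 *m mx2 1 0 c 1 \in SL2 F.
    by rewrite mul_mx2 mx2_SL2; apply/eqP; ring.
  by rewrite !toGLM ?upper_SL2 ?lower_SL2 // !groupM ?Ku ?Kl.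
apply/subsetP=> u; rewrite inE; set M : 'M[F]_2 := GLval u => SM.
have -> : u = toGL M by apply: val_inj; rewrite -[RHS]/(GLval (toGL M) : 'M[F]_2) toGLK.
have [c0|] := eqVneq (M 1 0) 0; last exact: Kc.
rewrite -(groupMr _ (Kl 1)) /lower -toGLM ?lower_SL2 //; apply: Kc.
  by rewrite inE det_mulmx; move: SM (lower_SL2 1); rewrite !inE => /eqP-> /eqP->; rewrite mulr1.
move: SM c0; rewrite (mx2E M); move: (M 0 0) (M 0 1) (M 1 0) (M 1 1) => a b c d.
rewrite mul_mx2 mx2_SL2 !mxE /= => detM c0.
apply: contraTneq detM; rewrite c0 !mul0r ?mulr1 add0r => ->.
by rewrite !mulr0 subr0 eq_sym oner_eq0.
Qed.

(** * Degrees of the nontrivial irreducible characters *)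

Lemma uppers_sub_cfker (i : Iirr SL2gl_group) : uppers \subset cfker 'chi_i -> i = 0.
Proof.
move=> sUK; apply/eqP; rewrite -subGcfker.
have Ku x : upper x \in cfker 'chi_i by rewrite (subsetP sUK) ?mem_uppers.
(* The kernel is normal, so conjugating by [weyl] puts the lower transvections in it as well; it is
   then the whole group. *)
apply: SL2gl_sub_transvections => // x; rewrite -upperJ_weyl memJ_norm ?Ku //.
by rewrite (subsetP (normal_norm (cfker_normal _))) // mem_toGL ?weyl_SL2.
Qed.

(** Equality of the conjugates forces the linear character ['chi_j] to be 1 on all
    [upper ((s ^+ 2 - t ^+ 2) * z)]; if $s^2\ne t^2$ these exhaust [uppers], and [j] would be
    trivial. *)
Lemma conjg_Iirr_torus (j : Iirr uppers_group) s t : j != 0 -> s != 0 -> t != 0 ->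
  conjg_Iirr j (torus s) = conjg_Iirr j (torus t) -> s ^+ 2 = t ^+ 2.
Proof.
move=> nzj nzs nzt /(congr1 (fun k => 'chi_k)); rewrite !conjg_IirrE => eq_chi.
have lin_j : 'chi_j \is a linear_char by move/char_abelianP: uppers_abelian; apply.
have torusE r x : r != 0 -> ('chi_j ^ torus r)%CF (upper x) = 'chi_j (upper (r ^+ 2 * x)).
  move=> nzr; have /setIP[_ Nr] := torus_norm nzr.
  by rewrite cfConjgE // -(upperJ_torus _ nzr) conjgK.
apply: contraNeq nzj => ne_st; rewrite -subGcfker.
apply/subsetP=> _ /imsetP[x _ ->].
have nz_st : s ^+ 2 - t ^+ 2 != 0 by rewrite subr_eq0.
pose z := x / (s ^+ 2 - t ^+ 2).
have sz : s ^+ 2 * z = t ^+ 2 * z + x by rewrite /z; field.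
have := torusE s z nzs; rewrite eq_chi torusE // sz upperD lin_charM ?mem_uppers //.
rewrite -[LHS]mulr1 => /(mulfI (lin_char_neq0 lin_j (mem_uppers _))) chi_x.
by rewrite cfkerEirr inE -chi_x lin_char1.
Qed.

Lemma card_nonzero : #|[set t : F | t != 0]| = #|F|.-1.
Proof. by rewrite cardsE cardC1. Qed.

Lemma SL2_degree_lower_bound (i : Iirr SL2gl_group) :
  i != 0 -> #|F|.-1%:R <= 2 * 'chi_i 1%g.
Proof.
move=> nzi.
have NRes : 'Res[uppers_group] 'chi_i \is a character by rewrite cfRes_char ?irr_char.
have [j Cj nzj] : exists2 j, j \in irr_constt ('Res[uppers_group] 'chi_i) & j != 0.
  (* If every constituent of the restriction were trivial, [uppers] would lie in the kernel of
     ['chi_i]. *)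
  apply/exists_inP; apply: contra_neqT nzi => /exists_inPn Res0.
  apply: uppers_sub_cfker.
  have := cfker_Res uppers_sub (irr_char i); rewrite cfkerE // => kerE.
  suff : uppers \subset uppers :&: cfker 'chi_i by rewrite subsetI => /andP[].
  rewrite -kerE subsetI subxx; apply/bigcapsP=> j /Res0; rewrite negbK => /eqP->.
  by rewrite cfker_irr0.
pose D := [set t : F | t != 0].
have sTN : torus @: D \subset 'N_SL2gl(uppers).
  by apply/subsetP=> _ /imsetP[t Dt ->]; rewrite inE in Dt; apply: torus_norm.
have le_chi := card_conjg_Iirr_le_char1 uppers_sub sTN Cj.
apply: le_trans (ler_wpM2l (ler0n _ 2) le_chi); rewrite -natrM ler_nat.
rewrite -card_nonzero -/D -imset_comp -sum1_card.
(* The $q-1$ torus parameters are grouped by the conjugate they yield; each fibre lies in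
   $\{s,-s\}$, so at least $(q-1)/2$ conjugates are distinct. *)
rewrite (partition_big_imset (conjg_Iirr j \o torus)) /=.
rewrite mulnC -sum_nat_const; apply: leq_sum => _ /imsetP[s Ds ->].
rewrite sum1dep_card.
apply: leq_trans (_ : #|[set s; - s]| <= 2)%N; last by rewrite cards2; case: (_ != _).
apply/subset_leq_card/subsetP=> t; rewrite !inE => /andP[nzt /eqP eq_st].
have nzs : s != 0 by move: Ds; rewrite inE.
have /eqP := conjg_Iirr_torus nzj nzt nzs eq_st.
by rewrite eqf_sqr.
Qed.

(** * The order of SL(2,q), and transfer of the count to the group *)

Lemma card_SL2_le : (#|SL2 F| <= #|F| ^ 3)%N.
Proof.
(* Three entries determine the fourth through $ad-bc=1$: it is $d$ when $a\ne0$, and $c$ when $a=0$,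
   since then $b\ne0$. *)
pose f M := (M 0 0, M 0 1, if M 0 0 == 0 then M 1 1 else M 1 0).
have f_inj : {in SL2 F &, injective f}.
  move=> M N; rewrite (mx2E M) (mx2E N).
  move: (M 0 0) (M 0 1) (M 1 0) (M 1 1) (N 0 0) (N 0 1) (N 1 0) (N 1 1).
  move=> a b c d a' b' c' d'; rewrite !mx2_SL2 /f !mxE /= => /eqP detM /eqP detN [ea eb].
  rewrite -{}ea -{}eb in detN *; case: eqP => [a0|/eqP nza] e; rewrite -{}e in detN *.
    have nzb : b != 0.
      by apply: contra_eq_neq detM => ->; rewrite a0 !mul0r subr0 eq_sym oner_eq0.
    by congr mx2; apply: (mulfI nzb); move: detM; rewrite -detN => /addrI/oppr_inj.
  by congr mx2; apply: (mulfI nza); move: detM; rewrite -detN => /addIr.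
by rewrite -(card_in_imset f_inj) (leq_trans (max_card _)) // !card_prod -mulnA.
Qed.

Lemma SL2_imset : SL2 F = [set (GLval u : 'M[F]_2) | u : {'GL_2[F]} in SL2gl].
Proof.
apply/setP=> M; apply/idP/imsetP=> [SM|[u + ->]]; last by rewrite inE.
by exists (toGL M); rewrite ?mem_toGL ?toGLK.
Qed.

Lemma GLval_inj : injective (fun u : {'GL_2[F]} => GLval u : 'M[F]_2).
Proof. exact: val_inj. Qed.

Lemma card_SL2gl : #|SL2gl| = #|SL2 F|.
Proof. by rewrite SL2_imset card_imset //; apply: GLval_inj. Qed.

Lemma sum_SL2 (f : 'M[F]_2 -> nat) :
  (\sum_(M in SL2 F) f M = \sum_(u in SL2gl) f (GLval u))%N.
Proof. by rewrite SL2_imset big_imset //=; move=> u v _ _ /GLval_inj. Qed.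

Lemma collision_count_group a : a \in SL2 F ->
  collision_count a =
  (\sum_(b in SL2gl) \sum_(b' in SL2gl) \sum_(u1 in SL2gl) \sum_(u2 in SL2gl)
     \sum_(u3 in SL2gl) \sum_(u4 in SL2gl)
       ((toGL a * b^-1) ^ u1 * b ^ u2 == (toGL a * b'^-1) ^ u3 * b' ^ u4)%g)%N.
Proof.
move=> Sa; rewrite /collision_count.
do 6![rewrite sum_SL2; apply: eq_bigr => ? _].
by rewrite -(inj_eq GLval_inj) !conjgE !GL_MxE !GL_VxE toGLK // /mxconj !mulmxA.
Qed.

Lemma collision_count_le a : a \in SL2 F ->
  (collision_count a * #|F|.-1 ^ 4
     <= #|SL2 F| ^ 5 * (#|F|.-1 ^ 4 + 16 * #|SL2 F|))%N.
Proof.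
move=> Sa; rewrite collision_count_group // -card_SL2gl.
apply: (interleaved_collision_le (G := SL2gl_group)); first exact: mem_toGL.
exact: SL2_degree_lower_bound.
Qed.

Lemma card_SL2_le_pred : (#|SL2 F| <= (2 * #|F|.-1) ^ 3)%N.
Proof.
apply: leq_trans card_SL2_le _; rewrite leq_exp2r //.
have := finNzRing_gt1 F; case: #|F| => [|[|n]] // _.
by rewrite mul2n -addnn addSn ltnS leq_addl.
Qed.

End SL2.

Theorem mainTheorem4 :
  exists C c : R, Rlt R0 C /\ Rlt R0 c /\
    forall (F : finFieldType) (a : 'M[F]_2), a \in SL2 F ->
      Rle (collision_prob a)
          (Rdiv (Rplus R1 (Rmult C (Rpower (INR #|SL2 F|) (Ropp c))))
                (INR #|SL2 F|)).
Proof.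
(* The exponent comes from $|G|\le(2(q-1))^3$, and $256=16\cdot2^4$ combines the degree bound with
   the replacement of $q-1$ by $|G|^{1/3}/2$. *)
exists (IZR 256), (Rdiv (IZR 1) (IZR 3)); split; first lra; split; first lra.
move=> F a Sa; rewrite /collision_prob.
have INR_exp m n : INR (m ^ n)%N = pow (INR m) n.
  by elim: n => //= n IHn; rewrite expnS mult_INR IHn.
rewrite INR_exp; apply: (@collision_rate_le _ _ (INR #|F|.-1)).
- by apply/lt_0_INR/ssrnat.ltP/card_gt0P; exists a.
- by apply/lt_0_INR/ssrnat.ltP; have := finNzRing_gt1 F; case: #|F| => [|[]].
- have /ssrnat.leP/le_INR := card_SL2_le_pred F; by rewrite INR_exp mult_INR.
have /ssrnat.leP/le_INR := collision_count_le Sa.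
by rewrite !(mult_INR, INR_exp, plus_INR) [INR 16]INR_IZR_INZ.
Qed.
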